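(* Let $\kappa\ge1$, let $h:[0,\infty)\to[0,\infty)$ be strictly increasing and concave with $h(0)=0$, continuous on $[0,\infty)$ and differentiable on $(0,\infty)$, and let $f:\mathbb{R}^d\to\mathbb{R}$ be convex with $$h\!\left(\frac{d(x,\mathcal{X}_\star)^2}{\kappa}\right)\le f(x)-f_\star\le h\bigl(d(x,\mathcal{X}_\star)^2\bigr)\qquad\forall x\in\mathbb{R}^d.$$ Then the iterates of the heavy-ball method with restart (described in the context), started at any $x_0\in\mathbb{R}^d$, satisfy, for every $n$ that is a multiple of $\lfloor\kappa e\rfloor-1$, $$d(x_n,\mathcal{X}_\star)^2\le\left(1-\frac1{\kappa e}\right)^n d(x_0,\mathcal{X}_\star)^2 .$$
   Context: $f:\mathbb{R}^d\to\mathbb{R}$ has a non-empty set of global minimizers $\mathcal{X}_\star$; $f_\star=\min_{x} f(x)$; $d(x,\mathcal{X}_\star)=\min_{x_\star\in\mathcal{X}_\star}\|x-x_\star\|_2$; $e=\exp(1)$; $\partial f(x)$ is the convex subdifferential. Heavy-ball with restart (input $x_0$, $h$, $f_\star$): for $k=1,2,\dots$, choose $g_{k-1}\in\partial f(x_{k-1})$, let $l\in\{1,\dots,\lfloor\kappa e\rfloor-1\}$ be the integer congruent to $k$ modulo $\lfloor\kappa e\rfloor-1$, and set $$x_k=x_{k-1}-\frac1{2(l+1)}\,\frac{1}{h'\bigl(h^{-1}(f(x_{k-1})-f_\star)\bigr)}\,g_{k-1}+\frac{l-1}{l+1}(x_{k-1}-x_{k-2}).$$ (When $l=1$ the last term vanishes,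 so $x_{-1}$ is irrelevant.) $h'(0)\in(0,+\infty]$ denotes the right derivative at $0$, with $1/h'(0)=0$ if $h'(0)=+\infty$. *)

(* Defs.v *)
From HB Require Import structures.
From mathcomp Require Import all_boot all_order all_algebra.
From mathcomp Require Import all_classical all_reals all_analysis.

Set Implicit Arguments.
Unset Strict Implicit.
Unset Printing Implicit Defensive.

Import Order.TTheory GRing.Theory Num.Theory.
Import numFieldNormedType.Exports.

Local Open Scope classical_set_scope.
Local Open Scope ring_scope.

Definition dotp (R : realType) (d : nat) (u v : 'rV[R]_d) : R :=
  \sum_(i < d) u 0 i * v 0 i.

(* Euclidean norm: the library norm `|u| on 'rV[R]_d is the sup norm. *)
Definition norm2 (R : realType) (d : nat) (u : 'rV[R]_d) : R :=
  Num.sqrt (dotp u u).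

Definition minimizers (R : realType) (d : nat) (f : 'rV[R]_d -> R) :
  set 'rV[R]_d := [set x | forall y, f x <= f y].

(* The infimum is a minimum as soon as [minimizers f] is non-empty. *)
Definition fstar (R : realType) (d : nat) (f : 'rV[R]_d -> R) : R :=
  inf (range f).

(* For a closed non-empty [A], in particular for the set of minimizers of a
   convex real-valued function on R^d, the infimum is a minimum. *)
Definition dist2 (R : realType) (d : nat) (x : 'rV[R]_d) (A : set 'rV[R]_d) :
  R := inf [set norm2 (x - a) | a in A].

Definition subdifferential (R : realType) (d : nat) (f : 'rV[R]_d -> R)
    (x : 'rV[R]_d) : set 'rV[R]_d :=
  [set g | forall y, f x + dotp g (y - x) <= f y].

(* A function on [0, +oo[ is represented by h : R -> R, of which only the
   values on [0, +oo[ matter: this is the inverse of h restricted to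
   [0, +oo[, with junk value 0 outside the image of that restriction. *)
Definition inv_nneg (R : realType) (h : R -> R) (y : R) : R :=
  xget 0 [set t | 0 <= t /\ h t = y].

(* The derivative of h on [0, +oo[; at 0 it is the right derivative, which may
   be +oo. *)
Definition deriv_nneg (R : realType) (h : R -> R) (t : R) : \bar R :=
  if t == 0 then lim (((h s - h 0) / s)%:E @[s --> 0^'+])
  else (h^`()%classic t)%:E.

(* 1 / h'(t), where the inverse on \bar R satisfies +oo^-1 = 0. *)
Definition inv_deriv (R : realType) (h : R -> R) (t : R) : R :=
  fine ((deriv_nneg h t)^-1)%E.

(* floor (kappa * e) - 1, as a natural number: [Num.truncn] is the floor on
   nonnegative arguments. *)
Definition restart_period (R : realType) (kappa : R) : nat :=
  (Num.truncn (kappa * expR 1) - 1)%N.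

(* The recursion is written for x_{k+1}. At k = 0, where x_{k-1} is x_{-1}, the
   value x 0 read by [x k.-1] is irrelevant: there l = 1 and the momentum term
   vanishes. *)
Definition heavy_ball_restart (R : realType) (d : nat) (f : 'rV[R]_d -> R)
    (h : R -> R) (kappa : R) (x : nat -> 'rV[R]_d) : Prop :=
  forall k : nat, exists (g : 'rV[R]_d) (l : nat),
    [/\ subdifferential f (x k) g,
        (1 <= l <= restart_period kappa)%N,
        l = k.+1 %[mod restart_period kappa] &
        x k.+1 = x k
          - ((2 * l.+1%:R)^-1 * inv_deriv h (inv_nneg h (f (x k) - fstar f)))
              *: g
          + ((l%:R - 1) / (l%:R + 1)) *: (x k - x k.-1)].

(* Main.v *)
Require Import Defs.
From HB Require Import structures.
From mathcomp Require Import all_boot all_order all_algebra.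
From mathcomp Require Import all_classical all_reals all_analysis.
From mathcomp Require Import ring lra.

Set Implicit Arguments.
Unset Strict Implicit.
Unset Printing Implicit Defensive.

Import Order.TTheory GRing.Theory Num.Theory.
Import numFieldNormedType.Exports.

Local Open Scope classical_set_scope.
Local Open Scope ring_scope.

(** Since [h] is increasing and concave, [F y := h^-1 (f y - min f)] is convex,
    [g / h'(F y)] is a subgradient of [F] at [y] when [g] is one of [f], and
    [d(y, X)^2 / kappa <= F y <= d(y, X)^2]. Over one epoch [z_0, ..., z_N] the
    method is thus heavy ball on [F]; with [a] a minimizer and
    [v_i = (z_i - a) + i (z_i - z_{i-1})], the quantity
    [i F(z_{i-1}) + |v_i|^2] is nonincreasing in [i], and one extra virtual
    step from [z_N] yields [(N + 1) F(z_N) <= d(z_0, X)^2]. Hence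
    [d(z_N, X)^2 <= kappa / (N + 1) * d(z_0, X)^2], and since
    [N + 1 = floor (kappa e)] this factor is at most [(1 - 1 / (kappa e))^N]. *)

Lemma dotpDl (R : realType) (d : nat) (u v w : 'rV[R]_d) :
  dotp (u + v) w = dotp u w + dotp v w.
Proof. by rewrite /dotp -big_split; apply: eq_bigr => i _; rewrite mxE mulrDl. Qed.

Lemma dotpC (R : realType) (d : nat) (u v : 'rV[R]_d) : dotp u v = dotp v u.
Proof. by apply: eq_bigr => i _; rewrite mulrC. Qed.

Lemma dotpZl (R : realType) (d : nat) (c : R) (u v : 'rV[R]_d) :
  dotp (c *: u) v = c * dotp u v.
Proof. by rewrite /dotp mulr_sumr; apply: eq_bigr => i _; rewrite mxE mulrA. Qed.

Lemma dotpDr (R : realType) (d : nat) (u v w : 'rV[R]_d) :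
  dotp w (u + v) = dotp w u + dotp w v.
Proof. by rewrite dotpC dotpDl !(dotpC w). Qed.

Lemma dotpZr (R : realType) (d : nat) (c : R) (u v : 'rV[R]_d) :
  dotp u (c *: v) = c * dotp u v.
Proof. by rewrite dotpC dotpZl dotpC. Qed.

Lemma dotpp_ge0 (R : realType) (d : nat) (u : 'rV[R]_d) : 0 <= dotp u u.
Proof. by apply: sumr_ge0 => i _; rewrite -expr2 sqr_ge0. Qed.

Lemma sqr_norm2 (R : realType) (d : nat) (u : 'rV[R]_d) :
  norm2 u ^+ 2 = dotp u u.
Proof. by rewrite sqr_sqrtr // dotpp_ge0. Qed.

Lemma dist2_ge0 (R : realType) (d : nat) (y : 'rV[R]_d) (A : set 'rV[R]_d) :
  A !=set0 -> 0 <= dist2 y A.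
Proof.
move=> [a Aa]; apply: lb_le_inf; first by exists (norm2 (y - a)), a.
by move=> _ [b _ <-]; exact: sqrtr_ge0.
Qed.

Lemma sqr_dist2_le (R : realType) (d : nat) (y a : 'rV[R]_d)
    (A : set 'rV[R]_d) :
  A a -> dist2 y A ^+ 2 <= dotp (y - a) (y - a).
Proof.
move=> Aa; rewrite -sqr_norm2 ler_sqr ?nnegrE ?sqrtr_ge0 //; last first.
  by apply: dist2_ge0; exists a.
apply: ge_inf; last by exists a.
by exists 0 => _ [b _ <-]; exact: sqrtr_ge0.
Qed.

(** [Num.sqrt c] is a lower bound of the set whose infimum is the distance, so the claim follows
    without exhibiting a closest point of [A]. *)
Lemma le_sqr_dist2 (R : realType) (d : nat) (y : 'rV[R]_d)
    (A : set 'rV[R]_d) (c : R) :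
  A !=set0 -> 0 <= c -> (forall a, A a -> c <= dotp (y - a) (y - a)) ->
  c <= dist2 y A ^+ 2.
Proof.
move=> A0 c0 cle; rewrite -(sqr_sqrtr c0) ler_sqr ?nnegrE ?sqrtr_ge0 ?dist2_ge0 //.
case: (A0) => a Aa; apply: lb_le_inf; first by exists (norm2 (y - a)), a.
by move=> _ [b Ab <-]; rewrite ler_wsqrtr // cle.
Qed.

Lemma concave_chord (R : realType) (h : R -> R) (a b e : R) :
  convex_function (`[0, +oo[%classic : set R^o) (fun t : R => - h t) ->
  0 <= a -> 0 <= b -> 0 <= e <= 1 ->
  e * h a + (1 - e) * h b <= h (e * a + (1 - e) * b).
Proof.
move=> hc a0 b0 /andP[e0 e1].
have mem t : 0 <= t -> t \in (`[0, +oo[%classic : set R^o).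
  by move=> t0; rewrite inE /= in_itv /= t0.
have := hc (Itv01 e0 e1) a b (mem _ a0) (mem _ b0).
rewrite !convRE !mulrN -opprD lerN2; exact.
Qed.

(** For steps [e] in [(0, 1]], concavity bounds the difference quotient at [t] in the direction
    [s - t] below by [h s - h t]; the bound survives [e -> 0+]. *)
Lemma concave_le_tangent (R : realType) (h : R -> R) (s t : R) :
  convex_function (`[0, +oo[%classic : set R^o) (fun t : R => - h t) ->
  derivable h t 1 -> 0 <= s -> 0 <= t ->
  h s - h t <= h^`()%classic t * (s - t).
Proof.
move=> hc hd s0 t0.
have hdiff : differentiable h t by apply/derivable1_diffP.
have -> : h^`()%classic t * (s - t) = 'D_(s - t) h t.
  by rewrite derive1E !deriveE // mulrC -[in RHS](mulr1 (s - t)) -linearZ.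
have hdv : derivable h t (s - t) by exact: diff_derivable.
have hr := cvg_dnbhs_at_right hdv.
rewrite /derive -(cvg_lim _ hr) //.
apply: limr_ge; first by apply/cvg_ex; eexists; exact: hr.
near=> e.
have e0 : 0 < e by near: e; exact: nbhs_right_gt.
have e1 : e <= 1 by near: e; exact: nbhs_right_le.
have := concave_chord hc s0 t0 (introT andP (conj (ltW e0) e1)).
rewrite /= -[_ *: (s - t)]/(e * (s - t)) -[_ *: _]/(e^-1 * _) ler_pdivlMl //.
have -> : e * s + (1 - e) * t = e * (s - t) + t by ring.
lra.
Unshelve. all: by end_near. Qed.

(** With [s = F y], [t = F (x k)] and [u] the inner product of [g] with [y - x k], this is the
    subgradient inequality for [F]. It comes from dividing the tangent bound on [h] by its slope. *)
Lemma inv_deriv_mul_le (R : realType) (h : R -> R) (s t u : R) :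
  convex_function (`[0, +oo[%classic : set R^o) (fun t : R => - h t) ->
  (forall s t : R, 0 <= s -> s < t -> h s < h t) -> h 0 = 0 ->
  (forall t : R, 0 < t -> derivable h t 1) ->
  0 <= s -> 0 <= t -> u <= h s - h t -> inv_deriv h t * u <= s - t.
Proof.
move=> hc hincr h0 hd s0 t0 ule.
(* Any slope [a] of a line through [(t, h t)] lying above [h] will do. This covers both the
   derivative at [t > 0] and a finite right derivative at 0. *)
suff H a : (forall r, 0 <= r -> h r - h t <= a * (r - t)) ->
    a^-1 * u <= s - t.
  rewrite /inv_deriv /deriv_nneg; case: eqP => [t_eq0|/eqP t_neq0]; last first.
    rewrite fine_invr; apply: H => r r0; apply: concave_le_tangent => //.
    by apply: hd; rewrite lt_def t_neq0.
  subst t; rewrite h0.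
  set q := fun r : R => ((h r - 0) / r)%:E.
  (* By concavity and [h 0 = 0] the quotients are nonincreasing in [r], so their right limit at 0 is
     their supremum. *)
  pose L := ereal_sup [set q r | r in [set` `]0, +oo[]].
  have q_cvg : q r @[r --> 0^'+] --> L.
    apply: nonincreasing_at_right_cvge => //.
    move=> r1 r2; rewrite !in_itv /= !andbT => r1_gt0 r2_gt0 r12.
    rewrite lee_fin !subr0.
    have r01 : 0 <= r1 / r2 <= 1.
      by rewrite ler_pdivrMr // mul1r r12 divr_ge0 // ltW.
    have := concave_chord hc (ltW r2_gt0) (lexx 0) r01.
    rewrite h0 !mulr0 !addr0 divfK ?gt_eqF // => hle.
    rewrite ler_pdivlMr //; apply: le_trans hle.
    by rewrite le_eqVlt; apply/orP; left; apply/eqP; ring.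
  rewrite (cvg_lim _ q_cvg) //.
  have q_le r : 0 < r -> (q r <= L)%E.
    by move=> r0; apply: ereal_sup_ubound; exists r => //=; rewrite in_itv /= r0.
  (* [L] dominates [q 1], which excludes [-oo]. At [+oo] the inverse is 0 and only [0 <= s]
     remains. *)
  case: L q_le {q_cvg} => [a| |] q_le; last 1 first.
  - by have := q_le 1 ltr01.
  - rewrite fine_invr; apply: H => r r0; rewrite h0 !subr0.
    have [->|r_neq0] := eqVneq r 0; first by rewrite h0 mulr0.
    have r_gt0 : 0 < r by rewrite lt_def r_neq0.
    by have := q_le r r_gt0; rewrite lee_fin subr0 ler_pdivrMr.
  - by rewrite invey /= mul0r subr0.
move=> Ha.
(* Strict growth of [h] from [t] to [t + 1] forces a positive slope. *)
have a0 : 0 < a.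
  have := Ha (t + 1) (addr_ge0 t0 ler01).
  have := hincr t (t + 1) t0; rewrite ltrDl ltr01 => /(_ isT).
  by rewrite addrAC subrr add0r mulr1; lra.
by rewrite ler_pdivrMl //; apply: le_trans ule _; exact: Ha.
Qed.

(* [v i.+1 = v i - g i / 2], and the convexity and growth bounds on [F] turn
   the decrease of [|v i|^2] into a telescoping sum. *)
Lemma heavy_ball_epoch (R : realType) (d : nat) (F : 'rV[R]_d -> R)
    (z g : nat -> 'rV[R]_d) (a : 'rV[R]_d) (N : nat) :
  (forall y, F y <= dotp (y - a) (y - a)) ->
  (forall i y, (i <= N)%N -> F (z i) + dotp (g i) (y - z i) <= F y) ->
  (forall i, (i < N)%N -> z i.+1 = z i - (2 * i.+2%:R)^-1 *: g i
     + (i%:R / i.+2%:R) *: (z i - z i.-1)) ->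
  N.+1%:R * F (z N) <= dotp (z 0%N - a) (z 0%N - a).
Proof.
move=> Fle Fsub zS.
pose v i := (z i - a) + i%:R *: (z i - z i.-1).
have step i : (i <= N)%N -> i.+1%:R * F (z i) +
    dotp (v i - 2^-1 *: g i) (v i - 2^-1 *: g i) <=
    i%:R * F (z i.-1) + dotp (v i) (v i).
  move=> iN.
  (* Testing at [a + g i / 2], where [F] is at most [|g i|^2 / 4], gives
     [F (z i) + |g i|^2 / 4 <= <g i, z i - a>]. Adding [i] times the inequality at [z i.-1] turns
     the right side into [<g i, v i>], the cross term of [|v i - g i / 2|^2]. *)
  have := le_trans (Fsub i (a + 2^-1 *: g i) iN) (Fle _).
  have -> : a + 2^-1 *: g i - z i = 2^-1 *: g i + (-1) *: (z i - a).
    by apply/rowP => j; rewrite !mxE; ring.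
  have -> : a + 2^-1 *: g i - a = 2^-1 *: g i.
    by apply/rowP => j; rewrite !mxE; ring.
  have := Fsub i (z i.-1) iN.
  have -> : z i.-1 - z i = (-1) *: (z i - z i.-1).
    by apply/rowP => j; rewrite !mxE; ring.
  rewrite -scaleNr /v.
  move: (z i - a) (z i - z i.-1) => p w.
  rewrite !(dotpDl, dotpDr, dotpZl, dotpZr) !(dotpC _ (g i)) (dotpC w p).
  move=> /(ler_wpM2l (ler0n R i)) H1 H2.
  rewrite -[i.+1]addn1 natrD; lra.
have vS i : (i < N)%N -> v i.+1 = v i - 2^-1 *: g i.
  move=> iN; rewrite /v /= zS //; apply/rowP => j; rewrite !mxE.
  by rewrite -[i.+2]addn2 -[i.+1]addn1 !natrD; field; rewrite -natrD pnatr_eq0 addn2.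
(* At [i = 0] both occurrences of [z i.-1] have weight 0. *)
have inv i : (i <= N)%N ->
    i%:R * F (z i.-1) + dotp (v i) (v i) <= dotp (z 0%N - a) (z 0%N - a).
  elim: i => [_|i IH iN]; first by rewrite /v !scale0r mul0r add0r addr0.
  by rewrite vS //; apply: le_trans (step i (ltnW iN)) (IH (ltnW iN)).
(* [step N] is the virtual step; the squared norm it leaves is dropped. *)
apply: le_trans (inv N (leqnn N)); apply: le_trans (step N (leqnn N)).
by rewrite lerDl dotpp_ge0.
Qed.

(** The intermediate value theorem on [[a, b]] gives a preimage of [y], so [inv_nneg] does not fall
    back on its default value. *)
Lemma inv_nneg_spec (R : realType) (h : R -> R) (a b y : R) :
  {within `[0, +oo[%classic, continuous h} -> 0 <= a -> a <= b ->
  h a <= y <= h b -> 0 <= inv_nneg h y /\ h (inv_nneg h y) = y.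
Proof.
move=> hcont a0 ab /andP[ha hb].
apply: (xgetPex 0 (P := [set t | 0 <= t /\ h t = y])).
have hcont' : {within `[a, b], continuous h}.
  apply: continuous_subspaceW hcont => r /=; rewrite !in_itv /= andbT => /andP[ar _].
  exact: le_trans ar.
have [|t] := IVT ab hcont' (v := y).
  by rewrite ge_min ha le_max hb orbT.
by rewrite in_itv /= => /andP[at_ _] <-; exists t; split=> //; exact: le_trans at_.
Qed.

(* With [m = floor c], [(c / m) (c / (c - 1))^(m - 1)] is at most
   [exp ((c - m) / m + (m - 1) / (c - 1))], whose exponent is at most 1. *)
Lemma contraction_factor_le (R : realType) (c : R) (m : nat) :
  (0 < m)%N -> 1 < c -> m%:R <= c <= m%:R + 1 ->
  c / expR 1 / m%:R <= (1 - c^-1) ^+ m.-1.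
Proof.
move=> m0 c1 /andP[mc cm].
have mR0 : 0 < m%:R :> R by rewrite ltr0n.
have c_gt0 : 0 < c by lra.
have cm1_gt0 : 0 < c - 1 by lra.
have E1 : c / m%:R <= expR ((c - m%:R) / m%:R).
  apply: le_trans (expR_ge1Dx _); rewrite mulrBl divff ?gt_eqF //; lra.
have E2 : c / (c - 1) <= expR ((c - 1)^-1).
  apply: le_trans (expR_ge1Dx _); rewrite le_eqVlt; apply/orP; left; apply/eqP.
  by field; rewrite gt_eqF.
have E3 : (c / (c - 1)) ^+ m.-1 <= expR (m.-1%:R / (c - 1)).
  by rewrite expRM_natl lerXn2r // nnegrE ?expR_ge0 // divr_ge0 // ltW.
have E4 : c / m%:R * (c / (c - 1)) ^+ m.-1 <= expR 1.
  apply: (@le_trans _ _ (expR ((c - m%:R) / m%:R + m.-1%:R / (c - 1)))).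
    rewrite expRD; apply: ler_pM => //; first by rewrite divr_ge0 // ltW.
    by rewrite exprn_ge0 // divr_ge0 // ltW.
  rewrite ler_expR.
  have -> : m.-1%:R = m%:R - 1 :> R by rewrite -subn1 natrB.
  have -> : (m%:R - 1) / (c - 1) = 1 - (c - m%:R) / (c - 1).
    by field; rewrite gt_eqF.
  (* This holds because [c - 1 <= m <= c]. *)
  suff : (c - m%:R) / m%:R <= (c - m%:R) / (c - 1) by lra.
  by rewrite ler_wpM2l ?subr_ge0 // lef_pV2 ?posrE //; lra.
have -> : 1 - c^-1 = (c / (c - 1))^-1 by field; rewrite !gt_eqF.
rewrite exprVn -[X in _ <= X]mul1r ler_pdivlMr; last first.
  by rewrite exprn_gt0 // divr_gt0.
have -> : c / expR 1 / m%:R = (c / m%:R) / expR 1 by rewrite mulrAC.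
by rewrite mulrAC ler_pdivrMr ?expR_gt0 // mul1r.
Qed.

Theorem theoremG3 (R : realType) (d : nat) (kappa : R) (h : R -> R)
    (f : 'rV[R]_d -> R) (x : nat -> 'rV[R]_d)
    (kappa_ge1 : 1 <= kappa)
    (h_ge0 : forall t : R, 0 <= t -> 0 <= h t)
    (h_incr : forall s t : R, 0 <= s -> s < t -> h s < h t)
    (h_concave : convex_function (`[0, +oo[%classic : set R^o)
                   (fun t : R => - h t))
    (h0 : h 0 = 0)
    (h_cont : {within `[0, +oo[%classic, continuous h})
    (h_deriv : forall t : R, 0 < t -> derivable h t 1)
    (f_convex : convex_function [set: 'rV[R]_d] f)
    (f_min : minimizers f !=set0)
    (f_bounds : forall y : 'rV[R]_d,
        h (dist2 y (minimizers f) ^+ 2 / kappa) <= f y - fstar f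
          <= h (dist2 y (minimizers f) ^+ 2))
    (x_iter : heavy_ball_restart f h kappa x) :
  forall n : nat, (restart_period kappa %| n)%N ->
    dist2 (x n) (minimizers f) ^+ 2
      <= (1 - (kappa * expR 1)^-1) ^+ n * dist2 (x 0%N) (minimizers f) ^+ 2.
Proof.
have m_ge2 : (2 <= Num.truncn (kappa * expR 1))%N.
  rewrite truncn_ge_nat; last by rewrite mulr_ge0 ?expR_ge0 //; lra.
  have e2 : 2 <= expR 1 :> R by have := expR_ge1Dx (1 : R); lra.
  by apply: le_trans e2 _; rewrite ler_peMl // expR_ge0.
have c_itv := truncn_itv (mulr_ge0 (le_trans ler01 kappa_ge1) (expR_ge0 1)).
set c := kappa * expR 1 in m_ge2 c_itv *; set m := Num.truncn c in m_ge2 c_itv.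
have c_gt1 : 1 < c.
  by case/andP: c_itv => + _; apply: lt_le_trans; rewrite ltr1n.
set N := restart_period kappa; have N_def : N = m.-1 by rewrite -subn1.
have N_gt0 : (0 < N)%N by rewrite N_def; case: m m_ge2 {c_itv N_def} => [|[]].
set X := minimizers f; pose D y := dist2 y X ^+ 2.
pose F y := inv_nneg h (f y - fstar f).
have kappa_gt0 : 0 < kappa by lra.
have D_ge0 y : 0 <= D y by exact: sqr_ge0.
have h_reflect s t : 0 <= t -> h s <= h t -> s <= t.
  by move=> t0; apply: contra_le; exact: h_incr.
have F_spec y : [/\ 0 <= F y, h (F y) = f y - fstar f & D y / kappa <= F y <= D y].
  have Dk_ge0 : 0 <= D y / kappa by rewrite divr_ge0 // ltW.
  have Dk_le : D y / kappa <= D y by rewrite ler_pdivrMr // ler_peMr.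
  have [F0 hF] := inv_nneg_spec h_cont Dk_ge0 Dk_le (f_bounds y).
  split=> //; case/andP: (f_bounds y) => lo hi.
  by apply/andP; split; apply: h_reflect => //; rewrite hF.
have [g Hg] := choice x_iter.
pose G k := inv_deriv h (F (x k)) *: g k.
have G_sub k y : F (x k) + dotp (G k) (y - x k) <= F y.
  have [l [gk _ _ _]] := Hg k.
  have [Fx0 hFx _] := F_spec (x k); have [Fy0 hFy _] := F_spec y.
  have := gk y; rewrite -lerBrDl dotpZl -lerBrDl => H.
  apply: inv_deriv_mul_le => //; rewrite hFx hFy; lra.
have epoch j : D (x (j.+1 * N)%N) <= (1 - c^-1) ^+ N * D (x (j * N)%N).
  have F_le a : X a -> N.+1%:R * F (x (j.+1 * N)%N) <=
      dotp (x (j * N)%N - a) (x (j * N)%N - a).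
    move=> Xa.
    have := @heavy_ball_epoch R d F (fun i => x (j * N + i)%N)
      (fun i => G (j * N + i)%N) a N.
    rewrite addn0 addnC -mulSn; apply.
    - move=> y; have [_ _ /andP[_ FD]] := F_spec y.
      exact: le_trans FD (sqr_dist2_le _ Xa).
    - by move=> i y _; exact: G_sub.
    - move=> i iN; rewrite addnS.
      have [l [_ /andP[l_gt0 lN] l_mod ->]] := Hg (j * N + i)%N.
      (* Both sides lie in [1..N] and agree modulo [N]; subtracting 1 moves them to [0..N-1], where
         residues are unique. *)
      have l_eq : l = i.+1.
        case: l l_gt0 lN l_mod => // l _ lN /eqP.
        rewrite -/N -(addn1 l) -(addn1 (j * N + i)) eqn_modDr modnMDl.
        by rewrite !modn_small // => /eqP->; rewrite addn1.
      have pred_i : i.+1%:R - 1 = i%:R :> R by rewrite mulrSr addrK.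
      rewrite l_eq /G scalerA natr1 pred_i.
      (* At a restart, [i = 0], the method and the epoch lemma read different previous points, but
         the momentum coefficient is 0. *)
      by case: i {iN l_mod l_eq pred_i} => [|i]; rewrite ?addnS ?mul0r ?scale0r.
  have [Fz0 _ /andP[DF _]] := F_spec (x (j.+1 * N)%N).
  (* The epoch bound holds for every minimizer [a], hence with the squared distance on the right. *)
  have := le_sqr_dist2 f_min (mulr_ge0 (ler0n R N.+1) Fz0) F_le.
  rewrite -/(D _) -ler_pdivlMl ?ltr0n // => FD.
  rewrite ler_pdivrMr // in DF; apply: le_trans DF _.
  have := @contraction_factor_le R c m (ltnW m_ge2) c_gt1.
  rewrite -N_def => q_le.
  have m_eq : N.+1 = m by rewrite N_def prednK // ltnW.
  apply: (@le_trans _ _ (kappa / m%:R * D (x (j * N)%N))).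
    by rewrite -m_eq mulrC -mulrA ler_wpM2l // ltW.
  apply: ler_wpM2r => //.
  have <- : c / expR 1 = kappa by rewrite mulfK // gt_eqF // expR_gt0.
  apply: q_le; case/andP: c_itv => -> /ltW.
  by rewrite -natr1.
move=> n /dvdnP[j ->]; elim: j => [|j IH]; first by rewrite mul0n expr0 mul1r.
apply: le_trans (epoch j) _; rewrite mulSn exprD -mulrA ler_wpM2l //.
by rewrite exprn_ge0 // subr_ge0 invf_le1 ?ltW //; lra.
Qed.
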